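(* Let $q\in\mathbb{N}$ and let $W_1,\ldots,W_q$, $C$, $W_{\text{sync.}}$ be as defined in the context. Let $\{\sigma_k\}_{k\ge 0}$ be an i.i.d. sequence in $\{1,\ldots,q\}$ with $\mathbf{Pr}(\sigma_k=r)=\pi_r$, and let $Y^k$ evolve by $Y^{k+1}=W_{\sigma_k}Y^k+C$ from an arbitrary deterministic initial vector $Y^0$. Suppose $$\rho\left(\sum_{r=1}^{q}\pi_r\,(W_r\otimes W_r)\right)<1,$$ where $\rho$ denotes the spectral radius. Then the vector $Y^\star:=(I-W_r)^{-1}C$ is the same for all $r\in\{1,\ldots,q\}$, it equals the synchronous fixed point $Y^\star_{\text{sync.}}=(I-W_{\text{sync.}})^{-1}C$, and $Y^k$ converges to $Y^\star$ in the mean square sense, i.e. $\lim_{k\to\infty}\mathbb{E}\big[\|Y^k-Y^\star\|^2\big]=0$.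
   Context: Distributed quadratic program: minimize $\sum_{i=1}^N\left(\frac12 x_i^\top Q_ix_i+c_i^\top x_i\right)$ subject to $\sum_{i=1}^N A_ix_i\le b$, with $Q_i\in\mathbb{R}^{n_i\times n_i}$ symmetric positive definite, $c_i\in\mathbb{R}^{n_i}$, $A_i\in\mathbb{R}^{p\times n_i}$, $b\in\mathbb{R}^p$, and constant step sizes $\alpha_i$. Define $$\Phi_i:=\alpha_iA_iQ_i^{-1}A_i^\top,\qquad R:=\sum_{i=1}^N\Phi_i\in\mathbb{R}^{p\times p},\qquad B:=\sum_{i=1}^N\left(-\alpha_iA_iQ_i^{-1}c_i-\tfrac1N\alpha_ib\right)\in\mathbb{R}^p.$$ The dual variable is $y^k\in\mathbb{R}^p$, and the augmented state is $Y^k=[y^{k\top},y^{k-1\top},\ldots,y^{k-q+1\top}]^\top\in\mathbb{R}^{qp}$. In stochastic asynchronous dual decomposition, where at each step all nodes' values are taken with the same random delay (the oldest one), mode $r\in\{1,\ldots,q\}$ corresponds to the update $y^{k+1}=y^k-Ry^{k-r+1}+B$. Thus $W_r\in\mathbb{R}^{qp\times qp}$ is the $q\times q$ block matrix with $p\times p$ blocks whose first block row is $[I,0,\ldots,0]$ with $R$ subtracted from its $r$-th block (so $W_1$ has first block row $[I-R,0,\ldots,0]$), whose block $(j+1,j)$ is $I$ for $j=1,\ldots,q-1$, and whose other blocks are zero; $C=[B^\top,0,\ldots,0]^\top\in\mathbb{R}^{qp}$. The synchronous matrix $W_{\text{sync.}}$ is the block matrix with first block row $[I-R,0,\ldots,0]$,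 identity blocks in positions $(j+1,j)$, and zeros elsewhere. Here $\pi_r\ge0$ and $\sum_{r=1}^q\pi_r=1$. *)

(* Defs.v *)
From HB Require Import structures.
From mathcomp Require Import all_boot all_order all_algebra.
From mathcomp Require Import finmap complex.
From mathcomp Require Import all_classical all_reals all_analysis.

Set Implicit Arguments.
Unset Strict Implicit.
Unset Printing Implicit Defensive.

Import Order.TTheory GRing.Theory Num.Theory.
Import numFieldNormedType.Exports.

Local Open Scope classical_set_scope.
Local Open Scope ring_scope.

Definition posdefmx (R : realType) (n : nat) (M : 'M[R]_n) : Prop :=
  M^T = M /\ forall x : 'cV[R]_n, x != 0 -> 0 < (x^T *m M *m x) 0 0.

(* The canonical norm `|v| on matrices is the sup norm, hence this definition. *)
Definition euclidean_norm (R : realType) (n : nat) (v : 'cV[R]_n) : R :=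
  Num.sqrt (\sum_i v i 0 ^+ 2).

(* The set below is finite, so the supremum is a maximum when n > 0; it is
   0 when n = 0. *)
Definition spectral_radius (R : realType) (n : nat) (M : 'M[R]_n) : R :=
  sup [set ComplexField.Normc.normc z |
       z in [set z : R[i] | eigenvalue (map_mx (real_complex R) M) z]].

Section DualDecomposition.
Variables (R : realType) (N p : nat) (n : 'I_N -> nat) (alpha : 'I_N -> R).
Variables (Q : forall i, 'M[R]_(n i)) (A : forall i, 'M[R]_(p, n i)).
Variables (c : forall i, 'cV[R]_(n i)) (b : 'cV[R]_p).

Definition dual_Phi (i : 'I_N) : 'M[R]_p :=
  alpha i *: (A i *m invmx (Q i) *m (A i)^T).

Definition dual_R : 'M[R]_p := \sum_i dual_Phi i.

Definition dual_B : 'cV[R]_p :=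
  \sum_i (- (alpha i *: (A i *m invmx (Q i) *m c i))
          - (N%:R^-1 * alpha i) *: b).

End DualDecomposition.

(* Block indices and modes are zero-based: r : 'I_q stands for the mode r + 1,
   i.e. for the update y^(k+1) = y^k - Rm y^(k-r) + B. Block vectors and
   matrices have dimension \sum_(i < q) p = q * p. *)
Section AugmentedSystem.
Variables (R : realType) (p q : nat).

Definition async_block (Rm : 'M[R]_p) (r i j : 'I_q) : 'M[R]_p :=
  if i == 0 :> nat then
    (if j == 0 :> nat then 1%:M else 0) - (if j == r then Rm else 0)
  else if i == j.+1 :> nat then 1%:M else 0.

Definition async_mx (Rm : 'M[R]_p) (r : 'I_q) : 'M[R]_(\sum_(i < q) p) :=
  \mxblock_(i < q, j < q) async_block Rm r i j.

Definition sync_block (Rm : 'M[R]_p) (i j : 'I_q) : 'M[R]_p :=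
  if i == 0 :> nat then
    (if j == 0 :> nat then 1%:M - Rm else 0)
  else if i == j.+1 :> nat then 1%:M else 0.

Definition sync_mx (Rm : 'M[R]_p) : 'M[R]_(\sum_(i < q) p) :=
  \mxblock_(i < q, j < q) sync_block Rm i j.

Definition aug_offset (B : 'cV[R]_p) : 'cV[R]_(\sum_(i < q) p) :=
  \mxcol_(i < q) (if i == 0 :> nat then B else 0).

End AugmentedSystem.

Section IID.
Context {d : measure_display} {T : measurableType d} {R : realType}.
Variables (P : probability T R) (U : finType).

Definition mutually_independent (X : nat -> T -> U) : Prop :=
  forall (F : {fset nat}) (E : nat -> set U),
    P (\bigcap_(k in [set` F]) (X k @^-1` E k)) =
    (\prod_(k <- F) P (X k @^-1` E k))%E.

Definition iid_with_law (X : nat -> T -> U) (law : U -> R) : Prop :=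
  [/\ forall k (E : set U), measurable (X k @^-1` E),
      mutually_independent X
    & forall k u, P (X k @^-1` [set u]) = (law u)%:E].

End IID.

(* Main.v *)
(* The error e_k = Y^k - Y* satisfies e_(k+1) = W_(sigma_k) e_k, so by
   independence E[e_k (x) e_k] = M^k (e_0 (x) e_0) with
   M = sum_r pi_r W_r (x) W_r, and E|e_k|^2 is a linear functional of it. Since
   rho(M) < 1, M^k tends to 0: by Cayley-Hamilton a product of factors M - z with
   |z| < 1 annihilates every sequence M^k Z, and the factors can be peeled off one
   at a time, since x_(k+1) - z x_k --> 0 with |z| < 1 implies x_k --> 0.
   A vector v fixed by one W_r has all its blocks equal, hence is fixed by
   every W_r; then M^k fixes v (x) v, which forces v = 0. Thus every I - W_r is
   invertible, and the same observation identifies all the fixed points. *)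

Require Import Defs.
From HB Require Import structures.
From mathcomp Require Import all_boot all_order all_algebra.
From mathcomp Require character.
From mathcomp Require Import all_classical all_reals all_analysis.
From mathcomp Require Import measurable_realfun.
From mathcomp Require Import finmap complex lra.

Set Implicit Arguments.
Unset Strict Implicit.
Unset Printing Implicit Defensive.

Import Order.TTheory GRing.Theory Num.Theory.
Import numFieldNormedType.Exports.
Import ComplexField.Normc.

Local Open Scope classical_set_scope.
Local Open Scope ring_scope.

(** * Powers of a matrix of spectral radius less than one *)

Lemma cvg0_contraction (R : realType) (a w : nat -> R) (l : R) :
  0 <= l -> l < 1 -> (forall k, 0 <= a k) ->
  (forall k, a k.+1 <= l * a k + w k) ->
  w @ \oo --> 0 -> a @ \oo --> 0.
Proof.
move=> l0 l1 a0 aS w_cvg0; apply/cvgr0Pnorm_le => e e0.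
(* The constant makes [e / 2] the fixed point of t |-> l t + e (1 - l) / 2, so the bound [aK] below
   is preserved by the recursion. *)
have d0 : 0 < e * (1 - l) / 2 by rewrite divr_gt0// mulr_gt0// subr_gt0.
have [K _ wK] := (cvgr0Pnorm_le w).1 w_cvg0 _ d0.
have aK j : a (j + K)%N <= l ^+ j * a K + e / 2.
  elim: j => [|j IH]; first by rewrite expr0 mul1r lerDl divr_ge0// ltW.
  rewrite addSn (le_trans (aS _))//.
  have wj : w (j + K)%N <= e * (1 - l) / 2.
    by rewrite (le_trans (ler_norm _))//; apply: wK; exact: leq_addl.
  have lIH := ler_wpM2l l0 IH.
  apply: le_trans (lerD lIH wj) _.
  by rewrite exprS; lra.
have l_cvg0 : l ^+ j * a K @[j --> \oo] --> 0.
  rewrite -[X in _ --> X](mul0r (a K)); apply: cvgMr_tmp; apply: cvg_expr.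
  by rewrite ger0_norm.
have e20 : 0 < e / 2 by rewrite divr_gt0.
have [J _ lJ] := (cvgr0Pnorm_le _).1 l_cvg0 _ e20.
exists (J + K)%N => // k /= JKk; rewrite ger0_norm//.
have Kk : (K <= k)%N by rewrite (leq_trans _ JKk)// leq_addl.
have Jk : (J <= k - K)%N by rewrite leq_subRL// addnC.
have := aK (k - K)%N; rewrite subnK// => /le_trans; apply.
have := le_trans (ler_norm _) (lJ _ Jk); lra.
Qed.

Lemma cvg0_powers_annihilated (R : realType) (n : nat) (M : 'M[R[i]]_n.+1)
    (s : seq R[i]) (Z : 'M[R[i]]_n.+1) :
  {in s, forall z, normc z < 1} ->
  horner_mx M (\prod_(z <- s) ('X - z%:P)) * Z = 0 ->
  forall i j, normc ((M ^+ k * Z) i j) @[k --> \oo] --> 0.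
Proof.
elim: s Z => [|z s IH] Z s1.
  rewrite big_nil rmorph1 mul1r => -> i j.
  under eq_fun do rewrite mulr0 mxE normc0.
  exact: cvg_cst.
(* The factor X - z is moved to the right, where it is absorbed into [Z]: the induction hypothesis
   applies to (M - z) Z. *)
rewrite big_cons mulrC rmorphM rmorphB /= horner_mx_X horner_mx_C -mulrA => MZ i j.
have s1' : {in s, forall z, normc z < 1}.
  by move=> y ys; apply: s1; rewrite inE ys orbT.
have z1 : normc z < 1 by apply: s1; rewrite inE eqxx.
have w0 := IH _ s1' MZ i j.
apply: (cvg0_contraction _ z1 _ _ w0) => [|k|k].
- by case: (z) => *; exact: sqrtr_ge0.
- by case: (_ i j) => *; exact: sqrtr_ge0.
have -> : (M ^+ k * ((M - z%:M) * Z)) i j =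
    (M ^+ k.+1 * Z) i j - z * (M ^+ k * Z) i j.
  have -> : M ^+ k * ((M - z%:M) * Z) = M ^+ k.+1 * Z - z *: (M ^+ k * Z).
    rewrite mulrA mulrBr -exprSr mulrBl; congr (_ - _).
    by rewrite -[_ * z%:M]/(_ *m z%:M) mul_mx_scalar scalerAl.
  by rewrite !mxE.
rewrite -normcM addrC (le_trans _ (le_normcD _ _))//.
by rewrite subrK.
Qed.

Lemma cvg0_mx_powers (R : realType) (n : nat) (M : 'M[R]_n) :
  spectral_radius M < 1 -> forall i j, (M ^+ k) i j @[k --> \oo] --> 0.
Proof.
case: n M => [|n] M M1 i; first by case: i.
move=> j; set Mc := map_mx (real_complex R) M.
have [s charE] := closed_field_poly_normal (char_poly Mc).
move: charE; rewrite (monicP (char_poly_monic _)) scale1r => charE.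
have eigE z : eigenvalue Mc z = (z \in s).
  by rewrite eigenvalue_root_char charE root_prod_XsubC.
have s1 : {in s, forall z, normc z < 1}.
  move=> z zs; apply: le_lt_trans M1; apply: ub_le_sup.
    (* [sup] dominates the moduli only if they are bounded; their sum over all roots is a bound. *)
    exists (\sum_(y <- s) normc y) => _ [y yM <-].
    have ys : y \in s by rewrite -eigE.
    rewrite (big_rem y)//= lerDl sumr_ge0// => -[? ?] _; exact: sqrtr_ge0.
  by exists z => //=; rewrite eigE.
have CH : horner_mx Mc (\prod_(z <- s) ('X - z%:P)) * 1 = 0.
  by rewrite -charE Cayley_Hamilton mul0r.
have := cvg0_powers_annihilated s1 CH i j.
move=> /cvgr0Pnorm_le Mk0; apply/cvgr0Pnorm_le => e /Mk0; apply: filterS => k.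
rewrite mulr1 -rmorphXn mxE /= expr0n addr0 sqrtr_sqr.
by rewrite normr_id.
Qed.

(** * Tensor squares of vectors *)

Section TensorSquare.
Variables (F : fieldType) (m : nat).

(* The functional sending v (x) v to the sum of the squares of the entries of
   v; being itself a sum of Kronecker products, it is computed with [tprodE]
   alone, without indexing the entries of [tprod]. *)
Definition tsq_sqnorm : 'M[F]_(1 * 1, m * m) :=
  \sum_(i < m) character.tprod (delta_mx 0 i) (delta_mx 0 i).

(** The trace is multiplicative on Kronecker products, and a 1 by 1 matrix is determined by its
    trace. *)
Lemma tprod11 (a b : 'M[F]_1) : character.tprod a b 0 0 = a 0 0 * b 0 0.
Proof.
by have := character.mxtrace_prod a b; rewrite !(@trace_mx11 F).
Qed.

Lemma tsq_sqnormE (v : 'cV[F]_m) :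
  (tsq_sqnorm *m character.tprod v v) 0 0 = \sum_i v i 0 ^+ 2.
Proof.
rewrite mulmx_suml summxE; apply: eq_bigr => i _.
by rewrite -character.tprodE tprod11 -rowE !mxE expr2.
Qed.

End TensorSquare.

(** The value is a fixed linear combination of the entries of [M ^+ k], each of which tends to 0. *)
Lemma mean_square_powers_cvg0 (R : realType) (m : nat) (M : 'M[R]_(m * m))
    (u : 'cV[R]_m) :
  spectral_radius M < 1 ->
  (tsq_sqnorm R m *m (M ^+ k *m character.tprod u u)) 0 0 @[k --> \oo] --> 0.
Proof.
move=> /cvg0_mx_powers Mk0.
have -> : (fun k => (tsq_sqnorm R m *m (M ^+ k *m character.tprod u u)) 0 0) =
  (fun k => \sum_i \sum_j
     tsq_sqnorm R m 0 i * ((M ^+ k) i j * character.tprod u u j 0)).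
  apply/funext => k; rewrite mxE; apply: eq_bigr => i _.
  by rewrite mxE mulr_sumr.
rewrite -[X in _ --> X](_ : \sum_(i < m * m) \sum_(j < m * m) 0 = 0); last first.
  by rewrite big1// => i _; rewrite big1.
apply: cvg_big => [|i _]; first exact: add_continuous.
apply: cvg_big => [|j _]; first exact: add_continuous.
rewrite -[X in _ --> X](mulr0 (tsq_sqnorm R m 0 i)); apply: cvgMl_tmp.
by rewrite -[X in _ --> X](mul0r (character.tprod u u j 0)); exact: cvgMr_tmp.
Qed.

(** * Weighted sums over words in the matrices [W r] *)

Section RandomProducts.
Variables (R : realType) (m : nat) (U : finType).
Variables (W : U -> 'M[R]_m) (law : U -> R).

Let M := \sum_r law r *: character.tprod (W r) (W r).

(** By the mixed-product rule, (W_r (x) W_r)(v (x) v) = W_r v (x) W_r v, so the rightmost factor of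
    [M ^+ k.+1] accounts for the first letter, which acts on [v] first; the induction continues from
    [W r *m v]. *)
Lemma sum_words_tprod (k : nat) (v : 'cV[R]_m) :
  \sum_(t : k.-tuple U) (\prod_(i < k) law (tnth t i)) *:
    (let e := foldl (fun x r => W r *m x) v t in character.tprod e e) =
  M ^+ k *m character.tprod v v.
Proof.
elim: k v => [|k IH] v.
  rewrite expr0 mul1mx (big_pred1 [tuple]) => [|t]; last first.
    by apply/esym/eqP/val_inj; exact: size0nil (size_tuple t).
  by rewrite big_ord0 scale1r.
rewrite exprSr -mulmxA mulmx_suml mulmx_sumr.
pose cns (x : U * k.-tuple U) : k.+1.-tuple U := [tuple of x.1 :: x.2].
rewrite (reindex cns) /=; last first.
  exists (fun t => (thead t, behead_tuple t)) => [[r t] _|t _] /=.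
    by congr (_, _); apply/val_inj.
  by rewrite /cns /= -tuple_eta.
rewrite -(pair_bigA _ (fun r t => (\prod_(i < k.+1) law (tnth (cns (r, t)) i)) *:
  (let e := foldl (fun x r => W r *m x) (W r *m v) t in character.tprod e e))) /=.
apply: eq_bigr => r _.
rewrite -scalemxAl -character.tprodE -scalemxAr -IH scaler_sumr.
apply: eq_bigr => t _.
rewrite big_ord_recl scalerA; congr (_ * _ *: _).
by apply: eq_bigr => i _; congr law; rewrite !(tnth_nth r).
Qed.

(** As the weights sum to 1, [M] fixes v (x) v; the sum of the squares of the entries of [v] is then
    a constant sequence tending to 0. *)
Lemma common_fixed_vector0 (v : 'cV[R]_m) :
  \sum_r law r = 1 -> spectral_radius M < 1 ->
  (forall r, W r *m v = v) -> v = 0.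
Proof.
move=> law1 M1 Wv.
have Mv : M *m character.tprod v v = character.tprod v v.
  rewrite mulmx_suml -[RHS]scale1r -law1 scaler_suml; apply: eq_bigr => r _.
  by rewrite -scalemxAl -character.tprodE Wv.
have Mkv k : M ^+ k *m character.tprod v v = character.tprod v v.
  by elim: k => [|k IH]; rewrite ?expr0 ?mul1mx// exprSr -mulmxA Mv.
have := mean_square_powers_cvg0 v M1.
under eq_fun do rewrite Mkv tsq_sqnormE.
move=> /(cvg_unique _ (@cvg_cst _ _ _ _ _)) v0.
apply/colP => i; rewrite mxE; apply/eqP; rewrite -sqrf_eq0; apply/eqP.
move: v0 => /(_ _)/psumr_eq0P; apply=> //.
by move=> j _; exact: sqr_ge0.
Qed.

End RandomProducts.

(** * Expectations of finite-valued variables and the law of a random word *)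

Section FiniteValued.
Context {d : measure_display} {T : measurableType d} {R : realType}.
Variables (P : probability T R) (U : finType).

Lemma expectation_finite_valued (h : T -> U) (g : U -> R) :
  (forall u, measurable (h @^-1` [set u])) -> (forall u, 0 <= g u) ->
  ('E_P[fun w => g (h w)] = \sum_u (g u)%:E * P (h @^-1` [set u]))%E.
Proof.
move=> mh g0; rewrite unlock.
under eq_integral => w _.
  (* The integrand is split along the fibres of [h] into a finite sum of multiples of indicators. *)
  rewrite (_ : (g (h w))%:E =
      \sum_u ((g u)%:E * (\1_(h @^-1` [set u]) w)%:E))%E; last first.
    rewrite (bigD1 (h w))//= big1 => [|u uh].
      by rewrite indicE mem_set// mule1 adde0.
    by rewrite indicE memNset ?mule0//= => hu; move: uh; rewrite hu eqxx.
  over.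
rewrite ge0_integral_sum//.
- apply: eq_bigr => u _; rewrite ge0_integralZl//.
  + by rewrite integral_indic// setIT.
  + by apply/measurable_EFinP; exact: measurable_indic.
  + by rewrite lee_fin.
- move=> u; apply: measurable_funeM; apply/measurable_EFinP.
  exact: measurable_indic.
- by move=> u w _; rewrite mule_ge0// lee_fin.
Qed.

Variables (X : nat -> T -> U) (law : U -> R).
Hypothesis iidX : iid_with_law P X law.

Let wordset (k : nat) (t : k.-tuple U) :=
  (fun w => [tuple X i w | i < k]) @^-1` [set t].

(** Independence is stated for families indexed by all of [nat]: for j < k this is the singleton of
    the letter at position j, and beyond that the whole of [U]. *)
Let letterset (k : nat) (t : k.-tuple U) (j : nat) : set U :=
  [set u | forall i : 'I_k, i = j :> nat -> tnth t i = u].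

Let lettersetE k (t : k.-tuple U) (i : 'I_k) : letterset t i = [set tnth t i].
Proof.
apply/seteqP; split => u /=; first by move=> /(_ i erefl).
by move=> -> j /val_inj ->.
Qed.

Let wordsetE k (t : k.-tuple U) :
  wordset t = \bigcap_(j in [set` [fset j in iota 0 k]%fset])
    (X j @^-1` letterset t j).
Proof.
apply/seteqP; split => w /=.
  by move=> wt j _ i <-; rewrite -wt tnth_mktuple.
move=> wt; apply: eq_from_tnth => i; rewrite tnth_mktuple.
by rewrite (wt i _ i erefl)//= inE mem_iota/=.
Qed.

Lemma measurable_word (k : nat) (t : k.-tuple U) :
  measurable ((fun w => [tuple X i w | i < k]) @^-1` [set t]).
Proof.
rewrite [X in measurable X]wordsetE; apply: fin_bigcap_measurable => // j _.
by case: iidX.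
Qed.

Lemma probability_word (k : nat) (t : k.-tuple U) :
  P ((fun w => [tuple X i w | i < k]) @^-1` [set t]) =
  (\prod_(i < k) law (tnth t i))%:E.
Proof.
case: iidX => _ indepX lawX.
(* The product runs over the enumeration of the finite set, which is [iota 0 k] only up to
   permutation. *)
rewrite [X in P X]wordsetE indepX (perm_big (iota 0 k)); last first.
  apply: uniq_perm; rewrite ?fset_uniq ?iota_uniq// => j.
  by rewrite !inE.
rewrite -[X in iota 0 X]subn0 big_mkord -prodEFin; apply: eq_bigr => i _.
by rewrite lettersetE lawX.
Qed.

End FiniteValued.

(** * Block rows of the delay matrices *)

Section BlockCompanion.
Variables (R : realType) (p q : nat) (Rm : 'M[R]_p).
Implicit Types (r s i j : 'I_q) (v : 'cV[R]_(\sum_(i < q) p)).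

Local Notation W := (@async_mx R p q Rm).

Lemma submxcol_async_mul r v i :
  submxcol (W r *m v) i = \sum_j async_block Rm r i j *m submxcol v j.
Proof.
rewrite -submxcol_mul submxcol_matrix -[in LHS](submxcolK v).
by rewrite mul_mxrow_mxcol.
Qed.

Lemma submxcol_async_first r v i : i = 0 :> nat ->
  submxcol (W r *m v) i = submxcol v i - Rm *m submxcol v r.
Proof.
move=> i0; rewrite submxcol_async_mul /async_block i0 eqxx.
under eq_bigr do rewrite mulmxBl.
rewrite sumrB (bigD1 i)//= i0 eqxx mul1mx big1 ?addr0 => [|j]; last first.
  by rewrite -val_eqE /= i0 => /negPf ->; rewrite mul0mx.
rewrite (bigD1 r)//= eqxx big1 ?addr0// => j /negPf ->.
by rewrite mul0mx.
Qed.

Lemma submxcol_async_next r v i j : i = j.+1 :> nat ->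
  submxcol (W r *m v) i = submxcol v j.
Proof.
move=> ij; rewrite submxcol_async_mul /async_block ij /=.
rewrite (bigD1 j)//= eqxx mul1mx big1 ?addr0// => s /negPf sj.
by rewrite eqSS eq_sym val_eqE sj mul0mx.
Qed.

(* The shift rows of W_r force the blocks of v to be all equal, and then the
   delay r is irrelevant in the first row. *)
Lemma async_mx_mode_indep r s v :
  (forall i, i != 0 :> nat -> submxcol (W r *m v) i = submxcol v i) ->
  W s *m v = W r *m v.
Proof.
move=> fixv.
have shift i j : i = j.+1 :> nat -> submxcol v i = submxcol v j.
  by move=> ij; rewrite -fixv ?ij// (submxcol_async_next _ _ ij).
have const i j : i = 0 :> nat -> submxcol v j = submxcol v i.
  move=> i0; case: j => j; elim: j => [|j IH] jq.
    by congr submxcol; apply: val_inj.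
  by rewrite (shift _ (Ordinal (ltnW jq)))// IH.
apply/mxcolP => i; case: (posnP i) => [i0|i_gt0].
  by rewrite !submxcol_async_first// !(const i).
have iq : (i.-1 < q)%N by rewrite (leq_ltn_trans (leq_pred _)).
by rewrite !(@submxcol_async_next _ _ i (Ordinal iq))//= prednK.
Qed.

Lemma sync_mxE r : r = 0 :> nat -> sync_mx q Rm = W r.
Proof.
move=> r0; apply: eq_mxblock => i j; rewrite /sync_block /async_block.
case: (_ == 0)%N => //; rewrite -val_eqE /= r0.
by case: (_ == 0)%N; rewrite ?subrr ?subr0.
Qed.

Lemma submxcol_aug_offset (B : 'cV[R]_p) i : i != 0 :> nat ->
  submxcol (aug_offset q B) i = 0.
Proof. by move=> /negPf i0; rewrite /aug_offset mxcolK i0. Qed.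

End BlockCompanion.

(** * Error recursion and mean square convergence *)

Lemma affine_recursion_error (U : Type) (R : realType) (m : nat) (W : U -> 'M[R]_m)
    (C Y0 Ystar : 'cV[R]_m) (x : nat -> U) (Y : nat -> 'cV[R]_m) :
  (forall r, W r *m Ystar + C = Ystar) ->
  Y 0%N = Y0 -> (forall k, Y k.+1 = W (x k) *m Y k + C) ->
  forall k, Y k - Ystar =
    foldl (fun v r => W r *m v) (Y0 - Ystar) [tuple x i | i < k].
Proof.
move=> fixW Y0E YS k.
have -> : [tuple x i | i < k] = mkseq x k :> seq U.
  by rewrite /= /mkseq -val_enum_ord -map_comp.
elim: k => [|k IH]; first by rewrite Y0E.
(* Writing [Ystar] as its image under the current mode makes [C] cancel in the difference. *)
rewrite mkseqS foldl_rcons -IH YS -[X in _ - X](fixW (x k)) mulmxBr.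
by rewrite opprD addrACA subrr addr0.
Qed.

Lemma euclidean_norm_sqr (R : realType) (m : nat) (v : 'cV[R]_m) :
  euclidean_norm v ^+ 2 = \sum_i v i 0 ^+ 2.
Proof. by rewrite sqr_sqrtr// sumr_ge0// => i _; exact: sqr_ge0. Qed.

Theorem mainTheorem2 (R : realType)
    (N p : nat) (hN : (0 < N)%N)
    (n : 'I_N -> nat) (alpha : 'I_N -> R)
    (Q : forall i : 'I_N, 'M[R]_(n i)) (hQ : forall i : 'I_N, posdefmx (Q i))
    (A : forall i : 'I_N, 'M[R]_(p, n i))
    (c : forall i : 'I_N, 'cV[R]_(n i)) (b : 'cV[R]_p)
    (q : nat) (hq : (0 < q)%N)
    (prob : 'I_q -> R) (hprob0 : forall r : 'I_q, 0 <= prob r)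
    (hprob1 : \sum_(r < q) prob r = 1)
    (d : measure_display) (T : measurableType d) (P : probability T R)
    (sigma : nat -> T -> 'I_q) (hsigma : iid_with_law P sigma prob) :
  let Rm : 'M[R]_p := dual_R alpha Q A in
  let W : 'I_q -> 'M[R]_(\sum_(i < q) p) := async_mx Rm in
  let Wsync : 'M[R]_(\sum_(i < q) p) := sync_mx q Rm in
  let C : 'cV[R]_(\sum_(i < q) p) := aug_offset q (dual_B alpha Q A c b) in
  forall (Y0 : 'cV[R]_(\sum_(i < q) p))
         (Y : nat -> T -> 'cV[R]_(\sum_(i < q) p)),
  (forall w : T, Y 0%N w = Y0) ->
  (forall (k : nat) (w : T), Y k.+1 w = W (sigma k w) *m Y k w + C) ->
  spectral_radius (\sum_(r < q) prob r *: character.tprod (W r) (W r)) < 1 ->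
  [/\ forall r : 'I_q, 1%:M - W r \in unitmx,
      1%:M - Wsync \in unitmx
    & exists Ystar : 'cV[R]_(\sum_(i < q) p),
      [/\ forall r : 'I_q, invmx (1%:M - W r) *m C = Ystar,
          Ystar = invmx (1%:M - Wsync) *m C
        & ('E_P[fun w => (euclidean_norm (Y k w - Ystar) ^+ 2)%R])%E
            @[k --> \oo] --> 0%E]].
Proof.
move=> Rm W Wsync C Y0 Y Y0E YS rho1.
(* Index 0 is the undelayed mode, whose matrix is the synchronous one. *)
pose r0 := Ordinal hq.
have unitW r : 1%:M - W r \in unitmx.
  (* [det0P] provides a row vector in the left kernel, so it is applied to the transpose; [v^T] is
     then a nonzero vector fixed by [W r]. *)
  rewrite -unitmx_tr unitmxE unitfE; apply/negP => /det0P[v /negP v0 vW0].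
  apply: v0; rewrite -trmx_eq0; apply/eqP.
  have Wv : W r *m v^T = v^T.
    have : (1%:M - W r) *m v^T = 0.
      by apply: trmx_inj; rewrite trmx_mul trmxK vW0 trmx0.
    by rewrite mulmxBl mul1mx => /eqP; rewrite subr_eq0 => /eqP.
  apply: (common_fixed_vector0 hprob1 rho1) => s.
  by rewrite (async_mx_mode_indep (r := r))// => i _; rewrite -/(W r) Wv.
pose Ystar := invmx (1%:M - W r0) *m C.
have fix0 : W r0 *m Ystar + C = Ystar.
  have := mulKVmx (unitW r0) C; rewrite -/Ystar mulmxBl mul1mx => <-.
  by rewrite addrC subrK.
have fixW r : W r *m Ystar + C = Ystar.
  (* [C] vanishes below its first block, so on the shift rows [W r0] itself fixes [Ystar], which is
     all that mode independence requires. *)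
  rewrite -[RHS]fix0; congr (_ + _); apply: async_mx_mode_indep => i i0.
  by rewrite -[in RHS]fix0 submxcolD submxcol_aug_offset// addr0.
have -> : Wsync = W r0 by exact: sync_mxE.
split=> //; exists Ystar; split=> // [r|].
  have CE : (1%:M - W r) *m Ystar = C.
    by rewrite mulmxBl mul1mx -[X in X - _](fixW r) addrAC subrr add0r.
  by rewrite -CE mulKmx.
pose e0 := Y0 - Ystar.
pose M := \sum_(r < q) prob r *: character.tprod (W r) (W r).
pose err (t : seq 'I_q) := foldl (fun v r => W r *m v) e0 t.
(* The error at time k depends only on the word of the first k modes, so its mean square is a finite
   sum over words weighted by their probabilities, which [sum_words_tprod] evaluates. *)
have EY k : 'E_P[fun w => (euclidean_norm (Y k w - Ystar) ^+ 2)%R]%E =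
    ((tsq_sqnorm R _ *m (M ^+ k *m character.tprod e0 e0)) 0 0)%:E.
  under eq_fun => w do rewrite
    (affine_recursion_error (x := sigma ^~ w) (Y := Y ^~ w) fixW (Y0E w) (YS ^~ w)).
  rewrite (expectation_finite_valued P
    (h := fun w => [tuple sigma i w | i < k])
    (g := fun t : k.-tuple 'I_q => euclidean_norm (err t) ^+ 2)); last 2 first.
  - move=> t; exact: (measurable_word hsigma t).
  - by move=> t; exact: sqr_ge0.
  rewrite -sum_words_tprod mulmx_sumr summxE -sumEFin; apply: eq_bigr => t _.
  rewrite (probability_word hsigma) -EFinM euclidean_norm_sqr -tsq_sqnormE.
  by rewrite -scalemxAr [in RHS]mxE mulrC.
under eq_fun do rewrite EY.
apply: cvg_EFin; first by near=> k.
exact: mean_square_powers_cvg0.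
Unshelve. all: by end_near.
Qed.
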